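(* Let $F,\tilde F\in\mathscr{A}^2_{\mathbb{F}}([0,T]\times\Omega;\mathscr{G}(\mathbb{R}^d))$ be such that $\mathbb{E}\big[\int_0^Th^2(F_s,\tilde F_s)\,ds\big]<\infty$. Then for any $0\le t_0<t\le T$, $$h^2\Big(\int_{t_0}^tF_s\,ds,\int_{t_0}^t\tilde F_s\,ds\Big)\le (t-t_0)\int_{t_0}^th^2(F_s,\tilde F_s)\,ds,\qquad \mathbb{P}\text{-a.s.}$$
   Context: $(\Omega,\mathcal{F},\mathbb{P})$ is a complete probability space carrying a standard $m$-dimensional Brownian motion $B$ on $[0,T]$, and $\mathbb{F}=\{\mathcal{F}_t\}_{t\in[0,T]}$ is the natural filtration of $B$ augmented by the $\mathbb{P}$-null sets. $\mathscr{G}(\mathbb{R}^d)$ is the family of nonempty closed convex subsets of $\mathbb{R}^d$ (not necessarily bounded). $h$ is the Hausdorff distance, $h(A,B)=\max\{\sup_{a\in A}\inf_{b\in B}|a-b|,\ \sup_{b\in B}\inf_{a\in A}|a-b|\}\in[0,\infty]$. A closed-set-valued map $F$ is measurable if $\{F\cap E\ne\emptyset\}$ is measurable for every closed $E$. A (set-valued or single-valued) process is $\mathbb{F}$-non-anticipative if it is $\mathscr{B}([0,T])\otimes\mathcal{F}$-measurable and $\mathbb{F}$-adapted. For a non-anticipative set-valued process $F$, $S^2_{\mathbb{F}}(F)$ is the set of $\mathbb{F}$-non-anticipative $f\in\mathbb{L}^2([0,T]\times\Omega,\mathbb{R}^d)$ with $f\in F$ $dt\otimes d\mathbb{P}$-a.e.;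 $\mathscr{A}^2_{\mathbb{F}}([0,T]\times\Omega;\mathscr{G}(\mathbb{R}^d))$ is the set of $\mathscr{G}(\mathbb{R}^d)$-valued non-anticipative $F$ with $S^2_{\mathbb{F}}(F)\neq\emptyset$. Set-valued Lebesgue integral: for a $\sigma$-algebra $\mathcal{G}$, a set $V\subseteq\mathbb{L}^2_{\mathcal G}(\Omega,\mathbb{R}^d)$ is $\mathcal{G}$-decomposable if $\mathbf 1_Af+\mathbf 1_{A^c}g\in V$ for all $f,g\in V$, $A\in\mathcal{G}$; $\overline{\mathrm{dec}}_{\mathcal G}(V)$ is the $\mathbb{L}^2$-closure of the smallest $\mathcal{G}$-decomposable set containing $V$. For $0\le t_0\le t\le T$, $\int_{t_0}^tF_s\,ds$ is the ($\mathbb{P}$-a.s. unique) $\mathcal{F}_t$-measurable closed-set-valued random variable whose set of square-integrable $\mathcal{F}_t$-measurable selectors equals $\overline{\mathrm{dec}}_{\mathcal{F}_t}\{\int_{t_0}^tf_s\,ds: f\in S^2_{\mathbb{F}}(F)\}$. *)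

(* Defs.v *)
From HB Require Import structures.
From mathcomp Require Import all_boot all_order all_algebra.
From mathcomp Require Import all_classical all_reals all_analysis.

Set Implicit Arguments.
Unset Strict Implicit.
Unset Printing Implicit Defensive.
Import Order.TTheory GRing.Theory Num.Theory.
Import numFieldNormedType.Exports.

Local Open Scope classical_set_scope.
Local Open Scope ring_scope.

Section euclidean.
Context {R : realType} {d : nat}.
Implicit Types (A B : set 'rV[R]_d).

(* The library norm on matrices is the sup norm; it induces the same topology,
   but the Hausdorff distance depends on the choice of the norm. *)
Definition enorm (x : 'rV[R]_d) : R := Num.sqrt (\sum_i x ord0 i ^+ 2).

Definition hausdorff_excess A B : \bar R :=
  ereal_sup [set ereal_inf [set (enorm (a - b))%:E | b in B] | a in A].

Definition hausdorff_dist A B : \bar R :=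
  maxe (hausdorff_excess A B) (hausdorff_excess B A).

Definition closed_convex_sets : set (set 'rV[R]_d) :=
  [set A : set 'rV[R]_d | [/\ A !=set0, closed A & convex_set A]].

Definition borel_set : set (set 'rV[R]_d) := <<s [set U | open U] >>.

End euclidean.

(* Sub-sigma-algebras are represented by their set of events. *)
Section measurability.
Context {R : realType} {d : nat} {X : Type}.

Definition vec_measurable (G : set (set X)) (f : X -> 'rV[R]_d) :=
  forall C, borel_set C -> G (f @^-1` C).

Definition set_measurable (G : set (set X)) (F : X -> set 'rV[R]_d) :=
  forall E, closed E -> G [set x | F x `&` E !=set0].

End measurability.

Section brownian.
Context {R : realType} {disp : measure_display} {Omega : measurableType disp}.
Context (P : probability Omega R) (T : R) {m : nat}.
Implicit Type B : R -> Omega -> 'rV[R]_m.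

Definition past_events B (t : R) : set (set Omega) :=
  [set A | exists s C, [/\ 0 <= s <= t, borel_set C & A = B s @^-1` C]].

Definition natural_sigma B (t : R) : set (set Omega) := <<s past_events B t >>.

Definition augmented_sigma B (t : R) : set (set Omega) :=
  <<s past_events B t `|` P.-negligible >>.

(* The distribution N(0, (t - s) Id) is the product of the one-dimensional
   laws N(0, t - s); [normal_prob] takes the standard deviation. *)
Definition is_brownian B : Prop :=
  [/\ forall t, 0 <= t <= T -> vec_measurable measurable (B t),
      {ae P, forall w, B 0 w = 0},
      {ae P, forall w, {within `[0, T], continuous (fun t => B t w)}},
      forall s t, 0 <= s -> s < t -> t <= T ->
        forall A C, natural_sigma B s A -> borel_set C ->
        P (A `&` [set w | C (B t w - B s w)]) =
        (P A * P [set w | C (B t w - B s w)%R])%E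
    & forall s t, 0 <= s -> s < t -> t <= T ->
        forall C : 'I_m -> set R, (forall i, measurable (C i)) ->
        P [set w | forall i, C i ((B t w - B s w) ord0 i)] =
        (\prod_i normal_prob 0%R (Num.sqrt (t - s)%R) (C i))%E].

End brownian.

(* Processes are functions on the whole real line; only their values on
   [0, T] are ever used. *)
Section processes.
Context {R : realType} {disp : measure_display} {Omega : measurableType disp}.
Context (P : probability Omega R) (T : R) {d : nat}.
Context (Ft : R -> set (set Omega)).
Implicit Types (f : R -> Omega -> 'rV[R]_d) (F : R -> Omega -> set 'rV[R]_d).

Local Notation mu := (@lebesgue_measure R).

Definition strip : set (measurableTypeR R * Omega) := `[0, T] `*` setT.

(* The sets whose trace on [0, T] x Omega is in the product sigma-algebra. *)
Definition strip_sigma : set (set (measurableTypeR R * Omega)) :=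
  [set A | measurable (strip `&` A)].

Definition vec_nonanticipative f :=
  vec_measurable strip_sigma (fun p => f p.1 p.2) /\
  forall s, 0 <= s <= T -> vec_measurable (Ft s) (f s).

Definition set_nonanticipative F :=
  set_measurable strip_sigma (fun p => F p.1 p.2) /\
  forall s, 0 <= s <= T -> set_measurable (Ft s) (F s).

Definition S2 F : set (R -> Omega -> 'rV[R]_d) :=
  [set f | [/\ vec_nonanticipative f,
    (\int[mu \x P]_(p in strip) ((enorm (f p.1 p.2)) ^+ 2)%:E < +oo)%E &
    {ae (mu \x P)%E, forall p, strip p -> F p.1 p.2 (f p.1 p.2)}]].

Definition A2 : set (R -> Omega -> set 'rV[R]_d) :=
  [set F | [/\ forall s w, 0 <= s <= T -> closed_convex_sets (F s w),
    set_nonanticipative F & S2 F !=set0]].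

End processes.

Section decomposable.
Context {R : realType} {disp : measure_display} {Omega : measurableType disp}.
Context (P : probability Omega R) {d : nat}.
Implicit Types (G : set (set Omega)) (V : set (Omega -> 'rV[R]_d)).

Definition L2 G : set (Omega -> 'rV[R]_d) :=
  [set xi | vec_measurable G xi /\
    (\int[P]_w ((enorm (xi w)) ^+ 2)%:E < +oo)%E].

Definition L2_selectors G (X : Omega -> set 'rV[R]_d) :
    set (Omega -> 'rV[R]_d) :=
  [set xi | L2 G xi /\ {ae P, forall w, X w (xi w)}].

Definition decomposable G V : Prop :=
  forall f g A, V f -> V g -> G A ->
  V (fun w => \1_A w *: f w + \1_(~` A) w *: g w).

(* The closure is taken in L2(Omega, F); when V is in L2(Omega, G) and G
   contains the null sets, its elements are again G-measurable. *)
Definition L2_closure V : set (Omega -> 'rV[R]_d) :=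
  [set xi | L2 measurable xi /\
    forall e : R, 0 < e -> exists2 eta, V eta &
      (\int[P]_w ((enorm (xi w - eta w)) ^+ 2)%R%:E < (e ^+ 2)%:E)%E].

Definition closed_dec G V : set (Omega -> 'rV[R]_d) :=
  L2_closure (smallest (decomposable G) V).

End decomposable.

Section set_integral.
Context {R : realType} {disp : measure_display} {Omega : measurableType disp}.
Context (P : probability Omega R) (T : R) {d : nat}.
Context (Ft : R -> set (set Omega)).

Definition vec_integral (t0 t : R) (f : R -> Omega -> 'rV[R]_d) (w : Omega) :
    'rV[R]_d :=
  \row_i Rintegral lebesgue_measure `[t0, t] (fun s => f s w ord0 i).

(* [X] is a version of the integral of [F] from [t0] to [t], which is unique
   only up to almost sure equality. *)
Definition is_set_integral (F : R -> Omega -> set 'rV[R]_d) (t0 t : R)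
    (X : Omega -> set 'rV[R]_d) : Prop :=
  [/\ forall w, closed (X w), set_measurable (Ft t) X &
      L2_selectors P (Ft t) X =
      closed_dec P (Ft t) [set vec_integral t0 t f | f in S2 P T Ft F]].

End set_integral.

(* Main.v *)
(* Pushing a selection f of F to its pointwise projection f' on F' gives
   |f - f'| <= h(F, F') everywhere, so by Cauchy-Schwarz the integrals of f and
   f' differ by at most r, where r^2 is the right-hand side of the claim. This
   pointwise comparison of selectors survives decomposable combinations and
   L2-limits, hence holds for all square-integrable selectors of the two
   set-valued integrals. Applying it to countably many selectors that visit
   every rational ball met by X bounds the Hausdorff excess of X over X'
   by r. All measurable selections (projections included) are obtained by
   minimizing the coordinates of a point one after the other. *)
Require Import Defs.
From mathcomp Require Import all_boot all_order all_algebra.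
From mathcomp Require Import all_classical all_reals all_analysis.
From mathcomp Require Import measurable_realfun.
From mathcomp Require Import ring lra.
Import Order.TTheory GRing.Theory Num.Theory.
Import numFieldNormedType.Exports.
Local Open Scope classical_set_scope.
Local Open Scope ring_scope.

(** * Euclidean norm and minimizers *)

(** The bound r depends on the two processes alone and not on the selection. Decomposability needs
    exactly this: companions of two selections can be pasted along the same event without spoiling
    the estimate. For an L2-limit [f] of selectors no companion selector is constructed. What
    survives is a pointwise statement: for almost every [w] and every e > 0, some point of [X' w]
    lies within [r w + e] of [f w], and this is all that an excess asks for. Measurability of h(F,
    F') is never established. Every estimate against it therefore holds at each point of [0, T] x
    Omega and is integrated by plain monotonicity under iterated integrals; this is why a selection,
    which lies in F only almost everywhere, is first moved into F everywhere. Finiteness of the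
    expected integral of h^2 makes the projected process f' square integrable, hence a selection of
    F'. The bound is symmetric in the two processes, so exchanging them gives the other excess. *)

Section euclidean_norm.
Context {R : realType} {d : nat}.
Implicit Types (x y z : 'rV[R]_d) (A : set 'rV[R]_d).

Lemma enorm_ge0 x : 0 <= enorm x.
Proof. exact: sqrtr_ge0. Qed.

Lemma enorm_sqr x : enorm x ^+ 2 = \sum_i x ord0 i ^+ 2.
Proof. by rewrite sqr_sqrtr// sumr_ge0// => i _; exact: sqr_ge0. Qed.

Lemma enormN x : enorm (- x) = enorm x.
Proof.
by congr Num.sqrt; apply: eq_bigr => i _; rewrite mxE sqrrN.
Qed.

Lemma enormBC x y : enorm (x - y) = enorm (y - x).
Proof. by rewrite -enormN opprB. Qed.

Lemma coord_le_enorm x i : `|x ord0 i| <= enorm x.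
Proof.
rewrite -(@ler_pXn2r _ 2)// ?nnegrE ?enorm_ge0// enorm_sqr real_normK ?num_real//.
by rewrite (bigD1 i)//= lerDl sumr_ge0// => j _; exact: sqr_ge0.
Qed.

Lemma enorm_eq0 x : enorm x = 0 -> x = 0.
Proof.
move=> x0; apply/rowP => i; apply/eqP; rewrite mxE -normr_le0 -x0.
exact: coord_le_enorm.
Qed.

Lemma enorm0 : enorm (0 : 'rV[R]_d) = 0.
Proof. by rewrite /enorm big1 ?sqrtr0// => i _; rewrite mxE expr0n. Qed.

(** Cauchy-Schwarz, by summing (b x_i - a y_i)^2 >= 0 with a = |x| and b = |y|: the square terms add
    up to 2 a^2 b^2. Dividing by 2 a b is the reason to treat zero vectors apart. *)
Lemma dot_le_enorm x y : \sum_i x ord0 i * y ord0 i <= enorm x * enorm y.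
Proof.
have [->|x0] := eqVneq x 0.
  by rewrite enorm0 mul0r big1// => i _; rewrite mxE mul0r.
have [->|y0] := eqVneq y 0.
  by rewrite enorm0 mulr0 big1// => i _; rewrite mxE mulr0.
have gt0 z : z != 0 -> 0 < enorm z.
  move=> z0; rewrite lt_neqAle enorm_ge0 andbT eq_sym.
  by apply: contra z0 => /eqP /enorm_eq0 ->.
set a := enorm x; set b := enorm y.
have ab0 : 0 < a * b by rewrite mulr_gt0 ?gt0.
rewrite -(ler_pM2l ab0) -(@ler_pM2l _ 2)// mulr_sumr mulr_sumr.
have -> : 2 * (a * b * (a * b)) = \sum_i (b ^+ 2 * x ord0 i ^+ 2 + a ^+ 2 * y ord0 i ^+ 2).
  by rewrite big_split/= -!mulr_sumr -!enorm_sqr -/a -/b; ring.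
apply: ler_sum => i _; rewrite -subr_ge0.
have -> : b ^+ 2 * x ord0 i ^+ 2 + a ^+ 2 * y ord0 i ^+ 2 -
   2 * (a * b * (x ord0 i * y ord0 i)) = (b * x ord0 i - a * y ord0 i) ^+ 2 by ring.
exact: sqr_ge0.
Qed.

Lemma ler_enormD x y : enorm (x + y) <= enorm x + enorm y.
Proof.
rewrite -(@ler_pXn2r _ 2)// ?nnegrE ?addr_ge0 ?enorm_ge0//.
rewrite sqrrD !enorm_sqr.
under eq_bigr do rewrite mxE sqrrD.
rewrite !big_split/= lerD2r lerD2l -mulr2n lerMn2r/=.
exact: dot_le_enorm.
Qed.

Lemma ler_enorm_dist z x y : enorm (x - y) <= enorm (x - z) + enorm (z - y).
Proof. by rewrite -[x - y](subrKA z) ler_enormD. Qed.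

Lemma continuous_enorm : continuous (@enorm R d).
Proof.
move=> x; apply: (@continuous_comp _ _ _ (fun x : 'rV[R]_d => \sum_i x ord0 i ^+ 2)
  (@Num.sqrt R)); last exact: sqrt_continuous.
move: x; apply: continuous_big => [|i _ x]; first exact: add_continuous.
apply: (@continuous_comp _ _ _ (fun x : 'rV[R]_d => x ord0 i) (fun a : R => a ^+ 2)).
  exact: coord_continuous.
exact: exprn_continuous.
Qed.

Lemma continuous_enormB y : continuous (fun x => enorm (y - x)).
Proof.
move=> x; apply: (@continuous_comp _ _ _ (fun x => y - x) enorm).
  by apply: continuousB; [exact: cst_continuous|move=> ?; exact: cvg_id].
exact: continuous_enorm.
Qed.

Lemma closed_le_fun (g : 'rV[R]_d -> R) (c : R) :
  continuous g -> closed [set x | g x <= c].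
Proof.
move=> cg; apply: (@preimage_closed _ _ g [set y | y <= c]) => [x _|]; first exact: cg.
exact: closed_le.
Qed.

Lemma open_lt_fun (g : 'rV[R]_d -> R) (c : R) :
  continuous g -> open [set x | g x < c].
Proof.
move=> cg; apply: (@open_comp _ _ g [set y | y < c]) => [x _|]; first exact: cg.
exact: open_lt.
Qed.

Lemma rational_approx x (e : R) : 0 < e ->
  exists q : 'rV[rat]_d, enorm (x - map_mx ratr q) < e.
Proof.
(* Each coordinate is approximated within [c]. Dividing by d + 1 keeps [c] positive for d = 0 and
   makes the final inequality d c^2 < (d + 1)^2 c^2 strict. *)
move=> e0; set c := e / d.+1%:R.
have c0 : 0 < c by rewrite divr_gt0.
have /choice[q qP] i : exists q : rat, `|x ord0 i - ratr q| < c.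
  have [|q] := @rat_in_itvoo R (x ord0 i - c) (x ord0 i + c); first by lra.
  by rewrite in_itv/= => qP; exists q; rewrite distrC ltr_distl.
exists (\row_i q i).
rewrite -(@ltr_pXn2r _ 2)// ?nnegrE ?enorm_ge0// ?ltW// enorm_sqr.
have -> : e = d.+1%:R * c by rewrite /c mulrC divfK.
apply: (@le_lt_trans _ _ (\sum_(i < d) c ^+ 2)).
  apply: ler_sum => i _; rewrite !mxE -(real_normK (num_real _)).
  by rewrite ler_pXn2r// ?nnegrE ?normr_ge0 ?(ltW c0)// ltW.
rewrite sumr_const card_ord [X in _ < X]exprMn -[X in X < _]mulr_natl ltr_pM2r ?exprn_gt0//.
by rewrite -natrX ltr_nat (leq_trans (ltnSn d))// leq_pmulr.
Qed.

End euclidean_norm.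

Section minimizers.
Context {R : realType} {d : nat}.
Implicit Types (A : set 'rV[R]_d) (g : 'rV[R]_d -> R).

Definition argmin g A : set 'rV[R]_d :=
  [set x | A x /\ forall y, A y -> g x <= g y].

Lemma argmin_sub g A : argmin g A `<=` A.
Proof. by move=> x []. Qed.

Lemma closed_argmin g A : continuous g -> closed A -> closed (argmin g A).
Proof.
move=> cg cA.
have -> : argmin g A = A `&` \bigcap_(y in A) [set x | g x <= g y].
  by apply/seteqP; split=> x [].
by apply: closedI => //; apply: closed_bigI => y _; exact: closed_le_fun.
Qed.

Lemma compact_argmin g A : continuous g -> compact A -> compact (argmin g A).
Proof.
move=> cg cA; apply: (subclosed_compact _ cA); last exact: argmin_sub.
apply: closed_argmin => //.
by apply: compact_closed => //; exact: norm_hausdorff.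
Qed.

Lemma argmin_neq0 g A : continuous g -> compact A -> A !=set0 ->
  argmin g A !=set0.
Proof.
move=> cg cA A0; have [|c] := EVT_min_rV (f := g) A0 cA.
  exact: continuous_subspaceT.
rewrite inE => Ac cP; exists c; split=> // y Ay.
by apply: cP; rewrite inE.
Qed.

Lemma compact_closed_eball A x (r : R) : closed A ->
  compact (A `&` [set y | enorm (x - y) <= r]).
Proof.
move=> cA; apply: bounded_closed_compact; last first.
  by apply: closedI => //; apply: closed_le_fun; exact: continuous_enormB.
exists (r + enorm x); split; first exact: num_real.
move=> M ltM y [Ay ry]; rewrite /Num.norm/= mx_normrE.
apply/bigmax_leP; split.
  by rewrite (le_trans _ (ltW ltM))// addr_ge0 ?enorm_ge0// (le_trans _ ry) ?enorm_ge0.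
move=> [i j] _; rewrite (ord1 i)/= (le_trans (coord_le_enorm y j))//.
rewrite (le_trans _ (ltW ltM))//; have := ler_enorm_dist x y 0.
by rewrite !subr0 enormBC => /le_trans -> //; rewrite lerD2r.
Qed.

(** Points farther from [x] than a given [a] in [A] cannot compete, so the minimum is sought on the
    compact part of [A] in the ball of radius |x - a|. *)
Lemma argmin_dist_neq0 A x : closed A -> A !=set0 ->
  argmin (fun y => enorm (x - y)) A !=set0.
Proof.
move=> cA [a Aa].
have [|b [[Ab bx] bP]] := @argmin_neq0 (fun y => enorm (x - y)) _
    (continuous_enormB x) (compact_closed_eball _ x (enorm (x - a)) cA).
  by exists a; split => /=.
exists b; split=> // y Ay.
have [yx|/ltW yx] := leP (enorm (x - y)) (enorm (x - a)); first exact: bP.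
exact: le_trans yx.
Qed.

Lemma compact_argmin_dist A x : closed A ->
  compact (argmin (fun y => enorm (x - y)) A).
Proof.
move=> cA; have [->|/set0P[a [Aa aP]]] := eqVneq (argmin (fun y => enorm (x - y)) A) set0.
  exact: compact0.
apply: (subclosed_compact _ (compact_closed_eball _ x (enorm (x - a)) cA)).
  by apply: closed_argmin => //; exact: continuous_enormB.
by move=> y [Ay yP]; split=> //; exact: yP.
Qed.

Definition lexmin (s : seq 'I_d) A : set 'rV[R]_d :=
  foldl (fun C i => argmin (fun x => x ord0 i) C) A s.

Lemma lexmin_sub s A : lexmin s A `<=` A.
Proof.
by elim: s A => [A x //|i s IH A x /IH]; exact: argmin_sub.
Qed.

Lemma lexmin_neq0 s A : compact A -> A !=set0 -> lexmin s A !=set0.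
Proof.
have cc i : continuous (fun x : 'rV[R]_d => x ord0 i).
  by move=> x; exact: coord_continuous.
elim: s A => [//|i s IH A cA A0].
by apply: IH; [exact: compact_argmin|exact: argmin_neq0].
Qed.

(** Later minimizations only shrink the set, so both points already attain the minimum of coordinate
    [i] at its stage. With all coordinates listed, at most one point is left. *)
Lemma lexmin_eq s A x y i : i \in s -> lexmin s A x -> lexmin s A y ->
  x ord0 i = y ord0 i.
Proof.
elim: s A => [//|j s IH A]; rewrite inE => /orP[/eqP -> xA yA|]; last exact: IH.
have [[Ax xP] [Ay yP]] := (lexmin_sub s _ _ xA, lexmin_sub s _ _ yA).
by apply/eqP; rewrite eq_le xP// yP.
Qed.

(** The default 0, taken on the empty set, has to be accounted for when this choice is shown to be
    measurable. *)
Definition lexmin_pt A : 'rV[R]_d := xget 0 (lexmin (enum 'I_d) A).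

Lemma lexmin_pt_in A : compact A -> A !=set0 -> A (lexmin_pt A).
Proof.
move=> cA A0; apply: (@lexmin_sub (enum 'I_d)).
by have [x xP] := lexmin_neq0 (enum 'I_d) _ cA A0; exact: (xgetI _ xP).
Qed.

(** The lexicographic choice among the nearest points makes the projection measurable without an
    argument for uniqueness. *)
Definition nearest A x := lexmin_pt (argmin (fun y => enorm (x - y)) A).

Lemma nearestP A x : closed A -> A !=set0 ->
  argmin (fun y => enorm (x - y)) A (nearest A x).
Proof.
move=> cA A0; apply: lexmin_pt_in; first exact: compact_argmin_dist.
exact: argmin_dist_neq0.
Qed.

Lemma nearest_id A x : closed A -> A x -> nearest A x = x.
Proof.
move=> cA Ax; have [|_ /(_ _ Ax)] := @nearestP A x cA; first by exists x.
rewrite subrr enorm0 => xn0; apply/esym/subr0_eq/enorm_eq0/eqP.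
by rewrite eq_le xn0 enorm_ge0.
Qed.

End minimizers.

(** * Measurable selections *)

Section sigma_algebra_operations.
Context {X : Type} {G : set (set X)}.
Hypothesis sG : sigma_algebra setT G.

Lemma sigma_setC A : G A -> G (~` A).
Proof. by case: sG => _ + _ => /(_ A); rewrite setTD. Qed.

Lemma sigma_setT : G setT.
Proof. by rewrite -setC0; apply: sigma_setC; case: sG. Qed.

Lemma sigma_bigcup (I : countType) (F : I -> set X) :
  (forall i, G (F i)) -> G (\bigcup_i F i).
Proof.
move=> GF; pose H n := if unpickle n is Some i then F i else set0.
have -> : \bigcup_i F i = \bigcup_n H n.
  apply/seteqP; split=> x [i _ Fx].
    by exists (pickle i) => //; rewrite /H pickleK.
  by move: Fx; rewrite /H; case: unpickle => // j Fx; exists j.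
case: sG => G0 _; apply => n; rewrite /H.
by case: unpickle.
Qed.

Lemma sigma_bigcap (I : countType) (F : I -> set X) :
  (forall i, G (F i)) -> G (\bigcap_i F i).
Proof.
move=> GF; rewrite -[X in G X]setCK; apply: sigma_setC.
by rewrite setC_bigcap; apply: sigma_bigcup => i; exact: sigma_setC.
Qed.

Lemma sigma_setU A B : G A -> G B -> G (A `|` B).
Proof.
move=> GA GB; rewrite [X in G X](_ : _ = \bigcup_(b : bool) if b then A else B).
  by apply: sigma_bigcup => -[].
apply/seteqP; split=> [x [Ax|Bx]|x [[] _ ?]]; [by exists true|by exists false|by left|by right].
Qed.

Lemma sigma_setI A B : G A -> G B -> G (A `&` B).
Proof.
move=> GA GB; rewrite -[X in G X]setCK setCI.
by apply/sigma_setC/sigma_setU; exact: sigma_setC.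
Qed.

End sigma_algebra_operations.

Section measurable_selection.
Context {R : realType} {d : nat} {X : Type} {G : set (set X)}.
Hypothesis sG : sigma_algebra setT G.
Implicit Types (f : X -> 'rV[R]_d) (Y : X -> set 'rV[R]_d).

Lemma vec_measurable_closed f :
  (forall C, closed C -> G (f @^-1` C)) -> vec_measurable G f.
Proof.
move=> fG; suff : @borel_set R d `<=` [set C | G (f @^-1` C)] by [].
rewrite /borel_set; apply: smallest_sub; last first.
  move=> U oU /=; rewrite -[U]setCK preimage_setC; apply: sigma_setC => //.
  by apply: (fG (~` U)); exact: open_closedC.
split=> [|A GA|A GA] /=.
- by rewrite preimage_set0; case: sG.
- by rewrite setTD preimage_setC; exact: sigma_setC.
- by rewrite preimage_bigcup; exact: sigma_bigcup.
Qed.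

Lemma vec_measurable_open f U : vec_measurable G f -> open U ->
  G (f @^-1` U).
Proof. by move=> fG oU; apply: fG; exact: sub_sigma_algebra. Qed.

(** The minimizers meet [E] exactly when [Y w] meets [E] and the minimum over that part does not
    exceed the minimum over [Y w]. Comparing minima takes only countably many tests: every rational
    level reached by [Y w] must be reached inside [E]. *)
Lemma argmin_set_measurable Y (g : X -> 'rV[R]_d -> R) :
  (forall w E, closed E -> Y w `&` E !=set0 ->
     argmin (g w) (Y w `&` E) !=set0) ->
  (forall E c, closed E ->
     G [set w | Y w `&` E `&` [set x | g w x <= c] !=set0]) ->
  set_measurable G Y ->
  set_measurable G (fun w => argmin (g w) (Y w)).
Proof.
move=> gmin gG YG E cE.
pose S E c := [set w | Y w `&` E `&` [set x | g w x <= c] !=set0].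
rewrite [X in G X](_ : _ = [set w | Y w `&` E !=set0] `&`
    \bigcap_(q : rat) (~` S setT (ratr q) `|` S E (ratr q))).
  apply: sigma_setI => //; first exact: YG.
  apply: sigma_bigcap => // q; apply: sigma_setU => //; last exact: gG.
  by apply: sigma_setC => //; apply: gG; exact: closedT.
apply/seteqP; split=> w.
  move=> [x [[Yx xP] Ex]]; split; first by exists x.
  move=> q _; have [|] := pselect (S setT (ratr q) w); last by left.
  move=> [y [[Yy _] /= yq]]; right; exists x; split=> //=.
  exact: le_trans (xP _ Yy) yq.
move=> [YE wP].
have [x [[Yx Ex] xP]] := gmin w E cE YE.
have [|y [[Yy _] yP]] := gmin w setT closedT; first by exists x.
exists x; split=> //; split=> // z Yz; apply: (@le_trans _ _ (g w y)); last exact: yP.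
rewrite leNgt; apply/negP => /rat_in_itvoo[q]; rewrite in_itv/= => /andP[yq qx].
have [|[z' [[Yz' Ez'] /= zq]]] := wP q I.
  by apply; exists y; split => //=; exact: ltW.
by have := xP _ (conj Yz' Ez'); rewrite leNgt (le_lt_trans zq).
Qed.

Lemma lexmin_set_measurable s Y : (forall w, compact (Y w)) ->
  set_measurable G Y -> set_measurable G (fun w => lexmin s (Y w)).
Proof.
have cc i : continuous (fun x : 'rV[R]_d => x ord0 i).
  by move=> x; exact: coord_continuous.
elim: s Y => [//|i s IH] Y cY YG; apply: IH => [w|]; first exact: compact_argmin.
apply: argmin_set_measurable => // [w E cE|E c cE].
  apply: argmin_neq0 => //; apply: (subclosed_compact _ (cY w)) => //.
  by apply: closedI => //; apply: compact_closed => //; exact: norm_hausdorff.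
rewrite [X in G X](_ : _ = [set w | Y w `&` (E `&` [set x | x ord0 i <= c]) !=set0]).
  by apply: YG; apply: closedI => //; exact: closed_le_fun.
by apply/seteqP; split=> w /=; rewrite setIA.
Qed.

Lemma lexmin_pt_measurable Y : (forall w, compact (Y w)) ->
  set_measurable G Y -> vec_measurable G (fun w => lexmin_pt (Y w)).
Proof.
move=> cY YG; apply: vec_measurable_closed => C cC.
have LG := lexmin_set_measurable (enum 'I_d) Y cY YG.
have LE w x : lexmin (enum 'I_d) (Y w) x -> lexmin_pt (Y w) = x.
  move=> xL; apply/rowP => i; apply: (lexmin_eq (enum 'I_d) (Y w)) => //.
    by rewrite mem_enum.
  exact: (xgetI _ xL).
(* Where [Y w] is empty the chosen point is the default 0, so those [w] contribute exactly when 0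
   lies in [C]. *)
rewrite [X in G X](_ : _ = [set w | lexmin (enum 'I_d) (Y w) `&` C !=set0] `|`
    (~` [set w | Y w `&` setT !=set0] `&` [set _ | C 0])).
  apply: sigma_setU => //; first exact: LG.
  apply: sigma_setI => //.
    by apply: sigma_setC => //; apply: YG; exact: closedT.
  have [C0|C0] := pselect (C 0).
    by rewrite (_ : [set _ | _] = setT); [exact: sigma_setT|apply/seteqP; split].
  by rewrite (_ : [set _ | _] = set0); [case: sG|apply/seteqP; split].
apply/seteqP; split=> w /=; rewrite setIT.
- move=> Cw; have [Y0|Y0] := pselect (Y w !=set0).
    have [x xL] := lexmin_neq0 (enum 'I_d) _ (cY w) Y0.
    by left; exists x; split => //; rewrite -(LE w x xL).
  right; split=> //; move: Cw; rewrite /lexmin_pt xgetPN// => x xL.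
  by apply: Y0; exists x; exact: lexmin_sub xL.
- move=> [[x [xL Cx]]|[Y0 C0]]; first by rewrite (LE w x).
  by rewrite /lexmin_pt xgetPN// => x xL; apply: Y0; exists x; exact: lexmin_sub xL.
Qed.

Lemma nearest_measurable Y f : (forall w, closed (Y w)) ->
  set_measurable G Y -> vec_measurable G f ->
  vec_measurable G (fun w => nearest (Y w) (f w)).
Proof.
move=> cY YG fG; apply: lexmin_pt_measurable => [w|].
  exact: compact_argmin_dist.
apply: argmin_set_measurable => // [w E cE|E c cE].
  by apply: argmin_dist_neq0; exact: closedI.
(* The ball around [f w] moves with [w], whereas measurability of [Y] only concerns fixed closed
   sets. A rational centre [q] close to [f w] and a radius enlarged by 1/(n+1) give fixed sets;
   intersecting over [n] recovers the original event because the minimal distance is attained. *)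
pose D n q : set X := [set w | enorm (f w - map_mx ratr q) < n.+1%:R^-1] `&`
  [set w | Y w `&` (E `&` [set x | enorm (map_mx ratr q - x) <= c + n.+1%:R^-1]) !=set0].
rewrite [X in G X](_ : _ = \bigcap_n \bigcup_(q : 'rV[rat]_d) D n q).
  apply: sigma_bigcap => // n; apply: sigma_bigcup => // q; apply: sigma_setI => //.
    apply: (vec_measurable_open f [set x | enorm (x - map_mx ratr q) < n.+1%:R^-1]) => //.
    rewrite (_ : [set _ | _] = [set x | enorm (map_mx ratr q - x) < n.+1%:R^-1]).
      by apply: open_lt_fun; exact: continuous_enormB.
    by apply/seteqP; split=> x /=; rewrite enormBC.
  by apply: YG; apply: closedI => //; apply: closed_le_fun; exact: continuous_enormB.
apply/seteqP; split=> w.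
  move=> [x [[Yx Ex] /= xc]] n _.
  have [q qn] : exists q, enorm (f w - map_mx ratr q) < n.+1%:R^-1.
    by apply: rational_approx; rewrite invr_gt0.
  exists q => //; split=> //; exists x; split=> //; split=> //=.
  rewrite [leRHS]addrC (le_trans (ler_enorm_dist (f w) _ _))// lerD// enormBC.
  exact: ltW.
move=> wD; have apx n : exists2 x, (Y w `&` E) x & enorm (f w - x) <= c + 2 * n.+1%:R^-1.
  have [q _ [/= qn [x [Yx [Ex /= xq]]]]] := wD n I; exists x => //.
  by have := ler_enorm_dist (map_mx ratr q) (f w) x; move: (n.+1%:R^-1) qn xq => b; lra.
have [|x [YEx xP]] := argmin_dist_neq0 (Y w `&` E) (f w) (closedI (cY w) cE).
  by have [x xP _] := apx 0%N; exists x.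
exists x; split=> //=; apply/ler_addgt0Pr => e e0.
(* With this choice 2/(n+1) < e; one 1/(n+1) pays for moving the centre, the other for the enlarged
   radius. *)
pose n := Num.truncn (2 / e).
have [y YEy yn] := apx n; apply: (le_trans (xP _ YEy)); apply: (le_trans yn).
rewrite lerD2l ler_pdivrMr// mulrC -ler_pdivrMr//.
exact/ltW/truncnS_gt.
Qed.

End measurable_selection.

(** * Measurability and integrals of vector-valued functions *)

Section vector_measurability.
Context {R : realType} {d : nat} {disp : measure_display}.
Context {Y : measurableType disp} (D : set Y).
Hypothesis mD : measurable D.
Implicit Types (f : Y -> 'rV[R]_d).

(** For [D] the strip this unfolds to [strip_sigma], so the selection lemmas apply to processes
    jointly in time and chance. *)
Definition trace_sigma : set (set Y) := [set A | measurable (D `&` A)].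

Lemma trace_sigma_algebra : sigma_algebra setT trace_sigma.
Proof.
split=> [|A mA|F mF]; rewrite /trace_sigma /=.
- by rewrite setI0; exact: measurable0.
- rewrite setTD (_ : _ `&` _ = D `\` (D `&` A)); first exact: measurableD.
  by rewrite setDIr setDv set0U setDE.
- by rewrite setI_bigcupr; exact: bigcupT_measurable.
Qed.

Lemma measurable_fun_coord f i : vec_measurable trace_sigma f ->
  measurable_fun D (fun p => f p ord0 i).
Proof.
move=> mf; apply: (measurability _ (RGenOpens.measurableE R)) => /= _ [_ [a [b ->] <-]].
have oU : open ((fun x : 'rV[R]_d => x ord0 i) @^-1` `]a, b[).
  by apply: open_comp => [x _|]; [exact: coord_continuous|exact: interval_open].
by have := mf _ (sub_sigma_algebra oU).
Qed.

Lemma measurable_enorm_sqr f : (forall i, measurable_fun D (fun p => f p ord0 i)) ->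
  measurable_fun D (fun p => enorm (f p) ^+ 2).
Proof.
move=> mf; under eq_fun do rewrite enorm_sqr.
apply: measurable_sum => i.
by apply: measurable_funX.
Qed.

End vector_measurability.

Lemma open_eball {R : realType} {d : nat} (U : set 'rV[R]_d) x : open U -> U x ->
  exists2 e : R, 0 < e & [set y | enorm (x - y) < e] `<=` U.
Proof.
move=> oU Ux; have /nbhs_ballP[e /= e0 eU] := open_nbhs_nbhs (conj oU Ux).
exists e => // y /= xy; apply: eU; rewrite -ball_normE /ball_/= {1}/Num.norm/= mx_normrE.
apply/bigmax_ltP; split=> // -[i j] _; rewrite (ord1 i)/=.
exact: le_lt_trans (coord_le_enorm (x - y) j) xy.
Qed.

(** An open set is the countable union of the rational balls it contains, and the preimage of such a
    ball is a sublevel set of |q - f|^2, which is measurable coordinate by coordinate. *)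
Lemma vec_measurable_coord {R : realType} {d : nat} {disp : measure_display}
    {Y : measurableType disp} (f : Y -> 'rV[R]_d) :
  (forall i, measurable_fun setT (fun p => f p ord0 i)) ->
  vec_measurable measurable f.
Proof.
move=> mf; apply: vec_measurable_closed => [|C cC].
  exact: sigma_algebra_measurable.
rewrite -[C]setCK preimage_setC; apply: measurableC; set U := ~` C.
have oU : open U by exact: closed_openC.
pose S (qn : 'rV[rat]_d * nat) : set Y :=
  if pselect ([set y | enorm (map_mx ratr qn.1 - y) < qn.2.+1%:R^-1] `<=` U) then
  [set w | enorm (map_mx ratr qn.1 - f w) < qn.2.+1%:R^-1] else set0.
rewrite [X in measurable X](_ : _ = \bigcup_qn S qn).
  apply: countable_bigcupT_measurable => [|[q n]]; first exact: countableP.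
  rewrite /S/=; case: pselect => [qU|qU] /=; last exact: measurable0.
  have mq : measurable_fun setT (fun w => enorm (map_mx ratr q - f w) ^+ 2).
    apply: measurable_enorm_sqr => i; under eq_fun do rewrite !mxE.
    by apply: measurable_funB => //; exact: measurable_cst.
  rewrite (_ : [set _ | _] = (fun w => enorm (map_mx ratr q - f w) ^+ 2) @^-1`
      [set r | r < n.+1%:R^-1 ^+ 2]).
    rewrite -[X in measurable X]setTI; apply: mq => //.
    by apply: open_measurable; exact: open_lt.
  by apply/seteqP; split=> w /=; rewrite ltr_pXn2r// ?nnegrE ?enorm_ge0// invr_ge0.
apply/seteqP; split=> w /=; last first.
  by move=> [[q n] _]; rewrite /S/=; case: pselect => /= [qU|] // /qU.
move=> /(open_eball _ _ oU)[e e0 eU].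
(* If [q] is within 1/(n+1) of [f w], the ball of that radius around [q] stays within 2/(n+1) < e of
   [f w], hence inside [U]. *)
pose n := Num.truncn (2 / e).
have ne : 2 * n.+1%:R^-1 < e.
  by rewrite ltr_pdivrMr// mulrC -ltr_pdivrMr// truncnS_gt.
have [|q qn] := rational_approx (f w) (n.+1%:R^-1 : R); first by rewrite invr_gt0.
exists (q, n) => //; rewrite /S/=; case: pselect => /= [_|]; first by rewrite enormBC.
case=> y /= qy; apply: eU => /=; apply: le_lt_trans (ler_enorm_dist (map_mx ratr q) _ _) _.
by move: (n.+1%:R^-1 : R) qn qy ne => b; lra.
Qed.

Section integrals.
Context {R : realType} {disp : measure_display} {Y : measurableType disp}.
Context (mu : {measure set Y -> \bar R}).
Local Open Scope ereal_scope.

(* The upper function will be h(F, F')^2, whose measurability would itself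
   require a Castaing representation. *)
Lemma le_integral_ge0 (D : set Y) (f g : Y -> \bar R) :
  (forall x, D x -> 0 <= f x) -> (forall x, D x -> f x <= g x) ->
  \int[mu]_(x in D) f x <= \int[mu]_(x in D) g x.
Proof.
move=> f0 fg; have g0 x : D x -> 0 <= g x.
  by move=> Dx; exact: le_trans (f0 x Dx) (fg x Dx).
rewrite !ge0_integralE//; apply: ereal_sup_le => _ [h hf <-]; exists h => //= x.
by rewrite (le_trans (hf x))// /patch; case: ifPn => // /[!inE]/fg.
Qed.

Lemma integrable_cst_fin (D : set Y) (c : R) : measurable D ->
  mu D < +oo -> mu.-integrable D (EFin \o cst c).
Proof.
move=> mD muD; apply: measurable_bounded_integrable => //.
by exists `|c|%R; split; [exact: num_real|move=> M cM x _ /=; exact: ltW].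
Qed.

Lemma integrable_of_sqr (D : set Y) (g : Y -> R) : measurable D ->
  mu D < +oo -> measurable_fun D g ->
  \int[mu]_(x in D) (g x ^+ 2)%R%:E < +oo -> mu.-integrable D (EFin \o g).
Proof.
move=> mD muD mg g2.
have i2 : mu.-integrable D (EFin \o (fun x => g x ^+ 2)%R).
  apply/integrableP; split; first exact/measurable_EFinP/measurable_funX.
  under eq_integral do rewrite /= ger0_norm ?sqr_ge0//.
  exact: g2.
have i1 : mu.-integrable D (EFin \o cst 1%R).
  exact: integrable_cst_fin.
apply: (le_integrable mD _ _ (integrableD mD i1 i2)) => [|x _ /=].
  exact/measurable_EFinP.
(* The dominating function is g^2 + 1, integrable because [D] has finite measure. *)
rewrite lee_fin -(real_normK (num_real (g x))) [leRHS]ger0_norm ?addr_ge0 ?sqr_ge0//.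
by have := sqr_ge0 (`|g x| - 1)%R; have := sqr_ge0 (`|g x|)%R; nra.
Qed.

Lemma sqr_Rintegral_le (D : set Y) (g : Y -> R) (L : R) : measurable D ->
  (0 < L)%R -> mu D = L%:E -> measurable_fun D g ->
  ((Rintegral mu D g) ^+ 2)%R%:E <= L%:E * \int[mu]_(x in D) (g x ^+ 2)%R%:E.
Proof.
move=> mD L0 muD mg.
have I0 : 0 <= \int[mu]_(x in D) (g x ^+ 2)%R%:E.
  by apply: integral_ge0 => x _; rewrite lee_fin sqr_ge0.
have [->|] := eqVneq (\int[mu]_(x in D) (g x ^+ 2)%R%:E) +oo.
  by rewrite gt0_muley ?lte_fin// leey.
rewrite -ltey => g2.
have ig : mu.-integrable D (EFin \o g).
  by apply: integrable_of_sqr => //; rewrite muD ltry.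
have i2 : mu.-integrable D (EFin \o (fun x => g x ^+ 2)%R).
  apply/integrableP; split; first exact/measurable_EFinP/measurable_funX.
  under eq_integral do rewrite /= ger0_norm ?sqr_ge0//.
  exact: g2.
(* Here [c] is the mean of [g], the optimal constant in 2 c g <= g^2 + c^2. Integrating gives 2 c m
   <= J + c^2 L with J the integral of g^2, that is m^2 <= L J since m = c L. *)
set m := Rintegral mu D g; pose c := (m / L)%R.
have ic : mu.-integrable D (EFin \o cst (c ^+ 2)%R).
  by apply: integrable_cst_fin => //; rewrite muD ltry.
have : (\int[mu]_(x in D) (2 * c * g x) <= \int[mu]_(x in D) (g x ^+ 2 + c ^+ 2))%R.
  apply: le_Rintegral => //.
  - exact: (integrableZl mD (2 * c) ig).
  - exact: (integrableD mD i2 ic).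
  - by move=> x _; have := sqr_ge0 (g x - c)%R; nra.
rewrite RintegralZl// RintegralD// Rintegral_cst// muD/= -/m.
rewrite -[\int[mu]_(x in D) (g x ^+ 2)%:E]fineK ?ge0_fin_numE// -EFinM lee_fin.
rewrite -/(Rintegral mu D (fun x => g x ^+ 2)%R).
have -> : m = (c * L)%R by rewrite /c divfK ?gt_eqF.
set J := Rintegral _ _ _ => h; have := ler_wpM2l (ltW L0) h; nra.
Qed.

End integrals.

(** * Sections of functions on a cylinder *)

Section cylinders.
Context {R : realType} {d1 d2 : measure_display}.
Context {T1 : measurableType d1} {T2 : measurableType d2}.
Context (m1 : {sigma_finite_measure set T1 -> \bar R}).
Context (m2 : {sigma_finite_measure set T2 -> \bar R}).
Context (D : set T1).
Hypothesis mD : measurable D.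
Local Open Scope ereal_scope.

Lemma measurable_cylinder : measurable (D `*` [set: T2]).
Proof. exact: measurableX. Qed.

Lemma measurable_cylinder_section {d} {U : measurableType d} (g : T1 * T2 -> U) y :
  measurable_fun (D `*` setT) g -> measurable_fun D (fun x => g (x, y)).
Proof.
move=> mg _ B mB.
have /(measurable_ysection y) := mg measurable_cylinder B mB.
rewrite (_ : ysection _ _ = D `&` (fun x => g (x, y)) @^-1` B)//.
by apply/seteqP; split=> x; rewrite /ysection/= inE/= => -[] // [].
Qed.

Implicit Types (g : T1 * T2 -> \bar R).

Let restrict_cylinder g x y : (g \_ (D `*` setT)) (x, y) = ((fun x => g (x, y)) \_ D) x.
Proof.
rewrite /patch; case: ifPn => [|]; first by rewrite inE => -[Dx _]; rewrite mem_set.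
by move=> + /=; case: ifPn => // /[!inE] Dx; rewrite notin_setE => -[].
Qed.

Let restrict_ge0 g : (forall p, (D `*` setT) p -> 0 <= g p) ->
  forall p, 0 <= (g \_ (D `*` setT)) p.
Proof. by move=> g0 p; rewrite /patch; case: ifPn => // /[!inE]/g0. Qed.

Let fubini_GE g y :
  fubini_G m1 (g \_ (D `*` setT)) y = \int[m1]_(x in D) g (x, y).
Proof.
rewrite /fubini_G [RHS]integral_mkcond; apply: eq_integral => x _.
exact: restrict_cylinder.
Qed.

Lemma measurable_cylinder_integral g : measurable_fun (D `*` setT) g ->
  (forall p, (D `*` setT) p -> 0 <= g p) ->
  measurable_fun setT (fun y => \int[m1]_(x in D) g (x, y)).
Proof.
move=> mg g0; under eq_fun do rewrite -fubini_GE.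
apply: measurable_fun_fubini_tonelli_G; last exact: restrict_ge0.
exact/(measurable_restrictT _ measurable_cylinder).
Qed.

Lemma tonelli_cylinder g : measurable_fun (D `*` setT) g ->
  (forall p, (D `*` setT) p -> 0 <= g p) ->
  \int[m1 \x m2]_(p in D `*` setT) g p = \int[m2]_y \int[m1]_(x in D) g (x, y).
Proof.
move=> mg g0; rewrite integral_mkcond fubini_tonelli2; last exact: restrict_ge0.
  by apply: eq_integral => y _; rewrite fubini_GE.
exact/(measurable_restrictT _ measurable_cylinder).
Qed.

(** The positive and negative parts have measurable extended integrals by Tonelli; [fine] of their
    difference is measurable even at points where the section fails to be integrable. *)
Lemma measurable_cylinder_Rintegral (g : T1 * T2 -> R) :
  measurable_fun (D `*` setT) g ->
  measurable_fun setT (fun y => Rintegral m1 D (fun x => g (x, y))).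
Proof.
move=> /measurable_EFinP mg.
apply: (@measurable_comp _ _ _ _ _ _ setT fine) => //.
have h y : \int[m1]_(x in D) (g (x, y))%:E =
    (\int[m1]_(x in D) (EFin \o g)^\+ (x, y)) -
    (\int[m1]_(x in D) (EFin \o g)^\- (x, y)).
  by rewrite integralE; congr (_ - _); apply: eq_integral => x _; rewrite ?funeposE ?funenegE.
under eq_fun do rewrite h.
by apply: emeasurable_funB; apply: measurable_cylinder_integral => //;
  [exact: measurable_funepos|exact: measurable_funeneg].
Qed.

(** By Tonelli applied to the indicator of an exceptional null set, the measure of its sections has
    integral zero, so almost every section is null. *)
Lemma ae_cylinder_section (Q : T1 * T2 -> Prop) :
  {ae m1 \x m2, forall p, D p.1 -> Q p} ->
  {ae m2, forall y, {ae m1, forall x, D x -> Q (x, y)}}.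
Proof.
move=> [N [mN N0 QN]].
have : {ae m2, forall y, m1 (ysection N y) = 0}.
  have mf : measurable_fun setT (m1 \o ysection N) by exact: measurable_fun_ysection.
  have /(ae_eq_integral_abs m2 measurableT mf) : \int[m2]_y `|(m1 \o ysection N) y| = 0.
    under eq_integral do rewrite /= gee0_abs//.
    rewrite -[RHS]N0 -[in RHS](setIT N) -(integral_indic (m1 \x m2)%E)//.
    rewrite fubini_tonelli2//; last first.
      exact/measurable_EFinP/measurable_indic.
    apply: eq_integral => y _; rewrite /fubini_G -[ysection N y]setIT -integral_indic//.
      by apply: eq_integral => x _; rewrite !indicE mem_ysection.
    exact: measurable_ysection.
  by apply: filterS => y; apply.
apply: filterS => y Ny; exists (ysection N y); split=> //.
  exact: measurable_ysection.
by move=> x /= nQ; rewrite /ysection/= inE; apply: QN => /= h; apply: nQ.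
Qed.

End cylinders.

(** * Selections of set-valued processes and their integrals *)

Section hausdorff.
Context {R : realType} {d : nat}.
Implicit Types (A B : set 'rV[R]_d).

Lemma hausdorff_excess_le A B (c : \bar R) :
  (forall a, A a -> forall e : R, 0 < e ->
     exists2 b, B b & ((enorm (a - b))%:E <= c + e%:E)%E) ->
  (hausdorff_excess A B <= c)%E.
Proof.
move=> cP; apply: ge_ereal_sup => _ [a Aa <-].
apply/lee_addgt0Pr => e e0; have [b Bb bc] := cP _ Aa _ e0.
by apply: (le_trans _ bc); apply: ereal_inf_lbound; exists b.
Qed.

(** Nonemptiness matters: for two empty sets both suprema are [-oo], and squaring is monotone only
    on nonnegative values. *)
Lemma hausdorff_dist_ge0 A B : A !=set0 -> (0 <= hausdorff_dist A B)%E.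
Proof.
move=> [a Aa]; rewrite le_max; apply/orP; left.
apply: le_ereal_sup_tmp; eexists; first by exists a.
by apply: le_ereal_inf_tmp => _ [b _ <-]; rewrite lee_fin enorm_ge0.
Qed.

Lemma enorm_argmin_le_hausdorff A B a b : A a ->
  argmin (fun y => enorm (a - y)) B b ->
  ((enorm (a - b))%:E <= hausdorff_dist A B)%E.
Proof.
move=> Aa [_ bP]; rewrite le_max; apply/orP; left.
apply: le_ereal_sup_tmp; eexists; first by exists a.
by apply: le_ereal_inf_tmp => _ [b' Bb' <-]; rewrite lee_fin bP.
Qed.

Lemma hausdorff_distC A B : hausdorff_dist A B = hausdorff_dist B A.
Proof. by rewrite /hausdorff_dist maxC. Qed.

Lemma lee_sqr_ge0 (x y : \bar R) : (0 <= x)%E -> (x <= y)%E -> (x ^+ 2 <= y ^+ 2)%E.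
Proof. by move=> x0 xy; rewrite !expe2 lee_pmul. Qed.

End hausdorff.

Section vector_integral.
Context {R : realType} {d : nat}.
Local Notation mu := (@lebesgue_measure R).

Lemma sqr_enorm_vec_integral_le (t0 t : R) (u : R -> 'rV[R]_d) : t0 < t ->
  (forall i, measurable_fun `[t0, t] (fun s => u s ord0 i)) ->
  ((enorm (\row_i Rintegral mu `[t0, t] (fun s => u s ord0 i)) ^+ 2)%:E <=
   (t - t0)%:E * \int[mu]_(s in `[t0, t]) (enorm (u s) ^+ 2)%:E)%E.
Proof.
move=> t0t mu_.
have mI : (mu `[t0, t] = (t - t0)%:E)%E.
  by rewrite lebesgue_measure_itv/= lte_fin t0t EFinB.
rewrite enorm_sqr -sumEFin; under eq_bigr do rewrite mxE.
under eq_integral do rewrite enorm_sqr -sumEFin.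
rewrite ge0_integral_sum//; last 2 first.
- by move=> i; apply/measurable_EFinP/measurable_funX; exact: mu_.
- by move=> i s _; rewrite lee_fin sqr_ge0.
rewrite ge0_sume_distrr; last first.
  by move=> i _; apply: integral_ge0 => s _; rewrite lee_fin sqr_ge0.
apply: lee_sum => i _; apply: sqr_Rintegral_le => //.
  by rewrite subr_gt0.
exact: mu_.
Qed.

End vector_integral.

Section processes.
Context {R : realType} {disp : measure_display} {Omega : measurableType disp}.
Context (P : probability Omega R) (T : R) {d : nat}.
Context (Ft : R -> set (set Omega)).
Hypothesis sFt : forall s, 0 <= s <= T -> sigma_algebra setT (Ft s).
Implicit Types (f : R -> Omega -> 'rV[R]_d) (F : R -> Omega -> set 'rV[R]_d).
Local Notation mu := (@lebesgue_measure R).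
Local Notation strip := (@strip R disp Omega T).
Local Notation S2 := (S2 P T Ft).
Local Notation A2 := (A2 P T Ft).

Lemma stripE (p : measurableTypeR R * Omega) : strip p <-> 0 <= p.1 <= T.
Proof. by rewrite /strip/= in_itv/=; split => [[]|]. Qed.

Lemma measurable_strip : measurable strip.
Proof. by apply: measurableX => //; exact: measurable_itv. Qed.

Lemma nearest_nonanticipative F f :
  (forall s w, 0 <= s <= T -> closed (F s w)) ->
  set_nonanticipative T Ft F -> vec_nonanticipative T Ft f ->
  vec_nonanticipative T Ft (fun s w => nearest (F s w) (f s w)).
Proof.
move=> cF [mF aF] [mf af]; split=> [|s sT]; last first.
  by apply: nearest_measurable => //; [exact: sFt|move=> w; exact: cF|exact: aF|exact: af].
(* The values of [F] are known to be closed only for times in [0, T]. Putting the closed set {0} at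
   other times allows projecting everywhere and changes no trace on the strip. *)
pose F1 (p : measurableTypeR R * Omega) := if 0 <= p.1 <= T then F p.1 p.2 else [set 0].
have : vec_measurable (strip_sigma T) (fun p => nearest (F1 p) (f p.1 p.2)).
  apply: nearest_measurable => //.
  - exact: (trace_sigma_algebra _ measurable_strip).
  - move=> p; rewrite /F1; case: ifPn => [|_]; first exact: cF.
    by apply: compact_closed; [exact: norm_hausdorff|exact: compact_set1].
  - move=> E cE; have := mF E cE; rewrite /strip_sigma/=.
    congr (measurable _); apply/seteqP; split=> p [/[dup] /stripE pT ? /=];
      by rewrite /F1 pT.
move=> h C bC; have := h C bC; rewrite /strip_sigma/=.
congr (measurable _); apply/seteqP; split=> p [/[dup] /stripE pT ? /=];
  by rewrite /F1 pT.
Qed.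

Lemma measurable_process_coord f i : vec_nonanticipative T Ft f ->
  measurable_fun strip (fun p => f p.1 p.2 ord0 i).
Proof.
by move=> [mf _]; exact: (measurable_fun_coord _ (fun p => f p.1 p.2)).
Qed.

Lemma measurable_process_sqr f : vec_nonanticipative T Ft f ->
  measurable_fun strip (fun p => (enorm (f p.1 p.2) ^+ 2)%:E).
Proof.
move=> mf; apply/measurable_EFinP/measurable_enorm_sqr => i.
exact: measurable_process_coord.
Qed.

Lemma measurable_process_sqrB f f' : vec_nonanticipative T Ft f ->
  vec_nonanticipative T Ft f' ->
  measurable_fun strip (fun p => (enorm (f p.1 p.2 - f' p.1 p.2) ^+ 2)%:E).
Proof.
move=> mf mf'; apply/measurable_EFinP/measurable_enorm_sqr => i.
under eq_fun do rewrite !mxE.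
by apply: measurable_funB; exact: measurable_process_coord.
Qed.

(** Projecting [f] onto [F] moves it into [F] at every point and leaves it alone wherever it was
    already there, hence almost everywhere. *)
Lemma S2_selection F f : A2 F -> S2 F f -> exists f1,
  [/\ S2 F f1, forall s w, 0 <= s <= T -> F s w (f1 s w) &
      {ae (mu \x P)%E, forall p, strip p -> f1 p.1 p.2 = f p.1 p.2}].
Proof.
move=> [ccF nF _] [nf f2 fF]; pose f1 s w := nearest (F s w) (f s w).
have cF s w : 0 <= s <= T -> closed (F s w) by move=> /(ccF s w)[].
have nf1 : vec_nonanticipative T Ft f1 by exact: nearest_nonanticipative.
have f1F s w : 0 <= s <= T -> F s w (f1 s w).
  by move=> sT; have [? ? _] := ccF s w sT; have [] := nearestP (F s w) (f s w).
have f1f : {ae (mu \x P)%E, forall p, strip p -> f1 p.1 p.2 = f p.1 p.2}.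
  apply: filterS fF => p fp /[dup] /stripE pT sp.
  by apply: nearest_id; [exact: cF|exact: fp].
exists f1; split=> //; split=> //.
- move: f2; congr (_ < _)%E; apply: ae_eq_integral.
  + exact: measurable_strip.
  + exact: measurable_process_sqr.
  + exact: measurable_process_sqr.
  + by apply: filterS f1f => p fp /fp ->.
- by apply: aeW => p /stripE; exact: f1F.
Qed.

Lemma tonelli_strip g : measurable_fun strip g ->
  (forall p, strip p -> 0 <= g p)%E ->
  (\int[mu \x P]_(p in strip) g p = \int[P]_w \int[mu]_(s in `[0%R, T]) g (s, w))%E.
Proof. by move=> mg g0; apply: tonelli_cylinder. Qed.

Lemma S2_companion F F' f : A2 F -> A2 F' ->
  (\int[P]_w \int[mu]_(s in `[0%R, T]) hausdorff_dist (F s w) (F' s w) ^+ 2 < +oo)%E ->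
  S2 F f -> (forall s w, 0 <= s <= T -> F s w (f s w)) ->
  exists2 f', S2 F' f' & forall s w, 0 <= s <= T ->
    ((enorm (f s w - f' s w) ^+ 2)%:E <= hausdorff_dist (F s w) (F' s w) ^+ 2)%E.
Proof.
move=> [ccF nF _] [ccF' nF' _] hFF' [nf f2 _] fF.
pose f' s w := nearest (F' s w) (f s w).
have cF' s w : 0 <= s <= T -> closed (F' s w) by move=> /(ccF' s w)[].
have nf' : vec_nonanticipative T Ft f' by exact: nearest_nonanticipative.
have f'P s w : 0 <= s <= T -> argmin (fun y => enorm (f s w - y)) (F' s w) (f' s w).
  by move=> sT; have [? ? _] := ccF' s w sT; exact: nearestP.
have f'h s w : 0 <= s <= T ->
    ((enorm (f s w - f' s w) ^+ 2)%:E <= hausdorff_dist (F s w) (F' s w) ^+ 2)%E.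
  move=> sT; rewrite EFin_expe; apply: lee_sqr_ge0; first by rewrite lee_fin enorm_ge0.
  by apply: enorm_argmin_le_hausdorff; [exact: fF|exact: f'P].
exists f' => //; split=> //; last first.
  by apply: aeW => p /stripE /f'P -/(_ p.2)[].
have mff' := measurable_process_sqrB f f' nf nf'.
(* Tonelli is applied to |f - f'|^2, which is measurable; only then is it compared with h^2, inside
   the iterated integral in which the hypothesis is stated. *)
have ff'2 : (\int[mu \x P]_(p in strip) (enorm (f p.1 p.2 - f' p.1 p.2) ^+ 2)%:E < +oo)%E.
  rewrite tonelli_strip//; last by move=> p _; rewrite lee_fin sqr_ge0.
  apply: le_lt_trans hFF'; apply: le_integral_ge0 => w _.
    by apply: integral_ge0 => s _; rewrite lee_fin sqr_ge0.
  apply: le_integral_ge0 => s; first by rewrite lee_fin sqr_ge0.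
  by rewrite /= in_itv/=; exact: f'h.
(* Square integrability of f' = f - (f - f') comes from |f'|^2 <= 2 |f|^2 + 2 |f - f'|^2. *)
pose g p := (2%:E * (enorm (f p.1 p.2) ^+ 2)%:E +
             2%:E * (enorm (f p.1 p.2 - f' p.1 p.2) ^+ 2)%:E)%E.
apply: (@le_lt_trans _ _ (\int[mu \x P]_(p in strip) g p)%E).
  apply: le_integral_ge0 => p _; first by rewrite lee_fin sqr_ge0.
  rewrite /g -!EFinM -EFinD lee_fin.
  have := ler_enormD (f p.1 p.2) (- (f p.1 p.2 - f' p.1 p.2)).
  rewrite enormN opprB addrC subrK.
  set a := enorm _; set b := enorm _; set c := enorm _ => abc.
  have : a ^+ 2 <= (b + c) ^+ 2.
    by rewrite ler_pXn2r ?nnegrE ?addr_ge0 ?enorm_ge0.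
  by have := sqr_ge0 (b - c); nra.
have ms := measurable_strip.
have mf := measurable_process_sqr f nf.
rewrite /g ge0_integralD//; last 4 first.
- by move=> p _; rewrite mule_ge0// lee_fin sqr_ge0.
- exact: measurable_funeM.
- by move=> p _; rewrite mule_ge0// lee_fin sqr_ge0.
- exact: measurable_funeM.
rewrite !ge0_integralZl//; try by move=> p _; rewrite lee_fin sqr_ge0.
by rewrite lte_add_pinfty// lte_mul_pinfty.
Qed.

Context (t0 t : R).
Hypotheses (ht0 : 0 <= t0) (ht0t : t0 < t) (htT : t <= T).

Let sub_itv : `[t0, t] `<=` `[0, T].
Proof.
move=> s; rewrite /= !in_itv/= => /andP[t0s st].
by rewrite (le_trans ht0 t0s) (le_trans st htT).
Qed.

Lemma measurable_section_coord f i w : vec_nonanticipative T Ft f ->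
  measurable_fun `[t0, t] (fun s => f s w ord0 i).
Proof.
move=> nf; apply: (measurable_funS _ sub_itv) => //.
exact: (measurable_cylinder_section _ _ (fun p => f p.1 p.2 ord0 i) _
   (measurable_process_coord f i nf)).
Qed.

Lemma integral_section_le f w : vec_nonanticipative T Ft f ->
  (\int[mu]_(s in `[t0, t]) (enorm (f s w) ^+ 2)%:E <=
   \int[mu]_(s in `[0%R, T]) (enorm (f s w) ^+ 2)%:E)%E.
Proof.
move=> nf; apply: ge0_subset_integral => //.
  exact: (measurable_cylinder_section _ _ (fun p => (enorm (f p.1 p.2) ^+ 2)%:E) _
    (measurable_process_sqr f nf)).
by move=> s _; rewrite lee_fin sqr_ge0.
Qed.

Lemma measurable_integral_sqr f : vec_nonanticipative T Ft f ->
  measurable_fun setT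
    (fun w => \int[mu]_(s in `[0%R, T]) (enorm (f s w) ^+ 2)%:E)%E.
Proof.
move=> nf.
have mD : measurable (`[0, T]%classic : set (measurableTypeR R)) by exact: measurable_itv.
apply: (measurable_cylinder_integral mu _ mD
  (fun p : measurableTypeR R * Omega => (enorm (f p.1 p.2) ^+ 2)%:E)).
  exact: measurable_process_sqr.
by move=> p _; rewrite lee_fin sqr_ge0.
Qed.

Lemma vec_integral_L2 F f : S2 F f -> L2 P measurable (vec_integral t0 t f).
Proof.
move=> [nf f2 _]; split.
  apply: vec_measurable_coord => i; under eq_fun do rewrite mxE.
  have mD : measurable (`[t0, t]%classic : set (measurableTypeR R)) by exact: measurable_itv.
  apply: (measurable_cylinder_Rintegral mu _ mD
    (fun p : measurableTypeR R * Omega => f p.1 p.2 ord0 i)) => //.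
  apply: (@measurable_funS _ _ _ _ strip); first exact: measurable_strip.
    by move=> [s w] [/sub_itv].
  exact: measurable_process_coord.
have mw := measurable_integral_sqr f nf.
apply: (@le_lt_trans _ _ (\int[P]_w ((t - t0)%:E *
    \int[mu]_(s in `[0%R, T]) (enorm (f s w) ^+ 2)%:E))%E).
  apply: le_integral_ge0 => w _; first by rewrite lee_fin sqr_ge0.
  apply: le_trans (sqr_enorm_vec_integral_le t0 t (fun s => f s w) ht0t _) _.
    by move=> i; exact: measurable_section_coord.
  by rewrite lee_pmul2l ?lte_fin ?subr_gt0//; exact: integral_section_le.
rewrite ge0_integralZl//; last 2 first.
- by move=> w _; apply: integral_ge0 => s _; rewrite lee_fin sqr_ge0.
- by rewrite lee_fin subr_ge0 ltW.
rewrite lte_mul_pinfty ?lee_fin ?subr_ge0 ?(ltW ht0t)//.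
rewrite -(tonelli_strip (fun p : measurableTypeR R * Omega => (enorm (f p.1 p.2) ^+ 2)%:E))//.
  exact: measurable_process_sqr.
by move=> p _; rewrite lee_fin sqr_ge0.
Qed.

(** The integral of |f|^2 over [0, T] has finite expectation, so it is almost surely finite, and on
    a bounded interval square integrability gives integrability. This licenses subtracting two
    integrals path by path. *)
Lemma ae_integrable_section F f : S2 F f ->
  {ae P, forall w, forall i, mu.-integrable `[t0, t] (fun s => (f s w ord0 i)%:E)}.
Proof.
move=> [nf f2 _].
pose I w := (\int[mu]_(s in `[0%R, T]) (enorm (f s w) ^+ 2)%:E)%E.
have I0 w : (0 <= I w)%E by apply: integral_ge0 => s _; rewrite lee_fin sqr_ge0.
have iI : P.-integrable setT I.
  apply/integrableP; split; first exact: measurable_integral_sqr.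
  under eq_integral do rewrite gee0_abs//.
  rewrite -(tonelli_strip (fun p : measurableTypeR R * Omega => (enorm (f p.1 p.2) ^+ 2)%:E))//.
    exact: measurable_process_sqr.
  by move=> p _; rewrite lee_fin sqr_ge0.
apply: filterS (integrable_ae measurableT iI) => w /(_ Logic.I).
rewrite ge0_fin_numE// => Iw i.
apply: integrable_of_sqr => //.
- by rewrite /= lebesgue_measure_itv/= lte_fin ht0t -EFinB ltry.
- exact: measurable_section_coord.
- apply: le_lt_trans Iw; apply: le_trans (integral_section_le f w nf).
  apply: le_integral_ge0 => s _; first by rewrite lee_fin sqr_ge0.
  rewrite lee_fin -(real_normK (num_real _)) ler_pXn2r ?nnegrE ?enorm_ge0//.
  exact: coord_le_enorm.
Qed.

Lemma vec_integral_ae_eq f f1 : vec_nonanticipative T Ft f ->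
  vec_nonanticipative T Ft f1 ->
  {ae (mu \x P)%E, forall p, strip p -> f1 p.1 p.2 = f p.1 p.2} ->
  {ae P, forall w, vec_integral t0 t f1 w = vec_integral t0 t f w}.
Proof.
move=> nf nf1 f1f.
have : {ae (mu \x P)%E, forall p, `[0, T]%classic p.1 -> f1 p.1 p.2 = f p.1 p.2}.
  by apply: filterS f1f => p fp pT; apply: fp.
move=> /ae_cylinder_section; apply: filterS => w fw.
apply/rowP => i; rewrite !mxE /Rintegral; congr fine.
apply: ae_eq_integral => //.
- by apply/measurable_EFinP; exact: (measurable_section_coord f1).
- by apply/measurable_EFinP; exact: (measurable_section_coord f).
- by apply: filterS fw => s fs /sub_itv /fs /= ->.
Qed.

Lemma vec_integral_companion F F' f : A2 F -> A2 F' ->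
  (\int[P]_w \int[mu]_(s in `[0%R, T]) hausdorff_dist (F s w) (F' s w) ^+ 2 < +oo)%E ->
  S2 F f -> exists2 f', S2 F' f' & {ae P, forall w,
    ((enorm (vec_integral t0 t f w - vec_integral t0 t f' w) ^+ 2)%:E <=
     (t - t0)%:E *
     \int[mu]_(s in `[t0, t]) hausdorff_dist (F s w) (F' s w) ^+ 2)%E}.
Proof.
move=> AF AF' hFF' Sf; have [f1 [Sf1 f1F f1f]] := S2_selection F f AF Sf.
have [f' Sf' f'h] := S2_companion F F' f1 AF AF' hFF' Sf1 f1F.
exists f' => //.
have [[nf _ _] [nf1 _ _] [nf' _ _]] := And3 Sf Sf1 Sf'.
have h1 := ae_integrable_section F f1 Sf1.
have h2 := ae_integrable_section F' f' Sf'.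
have h3 := vec_integral_ae_eq f f1 nf nf1 f1f.
move: h1 h2 h3; apply: filterS3 => w i1 i' <-.
(* Only after the two integrals are merged into that of f1 - f' does Cauchy-Schwarz in time produce
   the factor [t - t0]. *)
rewrite (_ : _ - _ = \row_i Rintegral mu `[t0, t] (fun s => (f1 s w - f' s w) ord0 i)).
  apply: le_trans (sqr_enorm_vec_integral_le t0 t (fun s => f1 s w - f' s w) ht0t _) _.
    move=> i; rewrite (_ : (fun s => _) = (fun s => f1 s w ord0 i - f' s w ord0 i)).
      by apply: measurable_funB;
        [exact: (measurable_section_coord f1)|exact: (measurable_section_coord f')].
    by apply/funext => s; rewrite !mxE.
  rewrite lee_pmul2l ?lte_fin ?subr_gt0//.
  apply: le_integral_ge0 => s st; first by rewrite lee_fin sqr_ge0.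
  by apply: f'h; move/sub_itv: st; rewrite /= in_itv.
apply/rowP => i; rewrite !mxE -RintegralB//; [|exact: i1|exact: i'].
by apply: eq_Rintegral => s _; rewrite !mxE.
Qed.

End processes.

(** * Selectors of set-valued random variables *)

Section gluing.
Context {R : realType} {d : nat} {X : Type}.
Implicit Types (A : set X) (f g : X -> 'rV[R]_d).

(** This is literally the combination in [decomposable], named so that it can be evaluated by
    cases. *)
Definition glue A f g : X -> 'rV[R]_d :=
  fun w => \1_A w *: f w + \1_(~` A) w *: g w.

Lemma glue_in A f g w : A w -> glue A f g w = f w.
Proof.
move=> Aw; rewrite /glue !indicE mem_set// memNset; last by move=> /(_ Aw).
by rewrite scale1r scale0r addr0.
Qed.

Lemma glue_out A f g w : ~ A w -> glue A f g w = g w.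
Proof.
by move=> Aw; rewrite /glue !indicE memNset// mem_set// scale1r scale0r add0r.
Qed.

Lemma glue_measurable (G : set (set X)) A f g : sigma_algebra setT G ->
  G A -> vec_measurable G f -> vec_measurable G g ->
  vec_measurable G (glue A f g).
Proof.
move=> sG GA mf mg C bC.
rewrite (_ : _ @^-1` _ = (A `&` f @^-1` C) `|` (~` A `&` g @^-1` C)).
  apply: sigma_setU => //; apply: sigma_setI => //; [exact: mf| |exact: mg].
  exact: sigma_setC.
apply/seteqP; split=> w /=.
  by have [Aw|Aw] := pselect (A w); [rewrite glue_in//; left|rewrite glue_out//; right].
by move=> [[Aw fw]|[Aw gw]]; [rewrite glue_in|rewrite glue_out].
Qed.

End gluing.

Section decomposable_hulls.
Context {R : realType} {disp : measure_display} {Omega : measurableType disp}.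
Context (P : probability Omega R) {d : nat} (G : set (set Omega)).
Hypotheses (sG : sigma_algebra setT G) (Gm : G `<=` measurable).
Implicit Types (V : set (Omega -> 'rV[R]_d)) (f g : Omega -> 'rV[R]_d).

Local Notation dec V := (smallest (decomposable G) V).

Lemma measurable_sqr_enormB f g : vec_measurable measurable f ->
  vec_measurable measurable g ->
  measurable_fun setT (fun w => (enorm (f w - g w) ^+ 2)%:E).
Proof.
have tr : trace_sigma setT = @measurable _ Omega.
  by apply/seteqP; split=> A; rewrite /trace_sigma/= setTI.
move=> mf mg; apply/measurable_EFinP/measurable_enorm_sqr => i.
rewrite (_ : (fun w => _) = (fun w => f w ord0 i - g w ord0 i)); last first.
  by apply/funext => w; rewrite !mxE.
by apply: measurable_funB; apply: measurable_fun_coord => //; rewrite tr.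
Qed.

Lemma measurable_sqr_enorm f : vec_measurable measurable f ->
  measurable_fun setT (fun w => (enorm (f w) ^+ 2)%:E).
Proof.
move=> mf; rewrite (_ : (fun w => _) = (fun w => (enorm (f w - 0) ^+ 2)%:E)).
  apply: (measurable_sqr_enormB f (fun=> 0)) => // C bC.
  rewrite preimage_cst; case: ifPn => _; [exact: measurableT|exact: measurable0].
by apply/funext => w; rewrite subr0.
Qed.

Lemma smallest_decomposable V : decomposable G (dec V).
Proof.
move=> f g A Vf Vg GA M [dM VM].
exact: dM (Vf M (conj dM VM)) (Vg M (conj dM VM)) GA.
Qed.

Lemma dec_L2 V : V `<=` L2 P measurable -> dec V `<=` L2 P measurable.
Proof.
move=> VL2; apply: smallest_sub => // f g A [mf f2] [mg g2] GA; split.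
  apply: (glue_measurable measurable) => //; last exact: Gm.
  exact: sigma_algebra_measurable.
have := lte_add_pinfty f2 g2.
rewrite -ge0_integralD//; last 4 first.
- by move=> w _; rewrite lee_fin sqr_ge0.
- exact: measurable_sqr_enorm.
- by move=> w _; rewrite lee_fin sqr_ge0.
- exact: measurable_sqr_enorm.
apply: le_lt_trans; apply: le_integral_ge0 => w _; first by rewrite lee_fin sqr_ge0.
rewrite -EFinD lee_fin -/(glue A f g w).
by have [Aw|Aw] := pselect (A w); [rewrite glue_in// lerDl|rewrite glue_out// lerDr];
  rewrite sqr_ge0.
Qed.

Lemma dec_sub_closure V : V `<=` L2 P measurable -> dec V `<=` closed_dec P G V.
Proof.
move=> VL2 f Vf; split; first exact: dec_L2 Vf.
move=> e e0; exists f => //; under eq_integral do rewrite subrr enorm0 expr0n.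
by rewrite integral0 lte_fin exprn_gt0.
Qed.

(** The functions that have a companion form a decomposable set containing [V]: companions are glued
    along the same event, and the common bound [r] holds on each piece. *)
Lemma dec_companion V V' (r : Omega -> \bar R) :
  (forall v, V v -> exists2 v', V' v' &
     {ae P, forall w, ((enorm (v w - v' w))%:E <= r w)%E}) ->
  forall f, dec V f -> exists2 f', dec V' f' &
     {ae P, forall w, ((enorm (f w - f' w))%:E <= r w)%E}.
Proof.
move=> VV'; pose W f := exists2 f', dec V' f' &
  {ae P, forall w, ((enorm (f w - f' w))%:E <= r w)%E}.
suff : dec V `<=` W by [].
apply: smallest_sub => [f g A [f' Vf' ff'] [g' Vg' gg'] GA|v /VV'[v' Vv' vv']].
  exists (glue A f' g'); first exact: (smallest_decomposable V' f' g' A Vf' Vg' GA).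
  apply: filterS2 ff' gg' => w fw gw; rewrite -/(glue A f g w).
  by have [Aw|Aw] := pselect (A w); [rewrite !glue_in|rewrite !glue_out].
by exists v' => // M [_]; exact.
Qed.

(** By Chebyshev, the probability that [g n] misses [f] by at least [e] tends to 0, so almost surely
    some [n] succeeds. The index may depend on [w], so no subsequence has to converge almost
    everywhere. *)
Lemma L2_closure_ae_approx V f : V `<=` L2 P measurable ->
  L2_closure P V f -> exists2 g : nat -> Omega -> 'rV[R]_d,
    forall n, V (g n) &
    forall e : R, 0 < e -> {ae P, forall w, exists n, enorm (f w - g n w) < e}.
Proof.
move=> VL2 [[mf _] fV].
have /choice[g gP] n : exists g, V g /\
    (\int[P]_w (enorm (f w - g w) ^+ 2)%:E < (n.+1%:R^-1 ^+ 2)%:E)%E.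
  by have [|g Vg fg] := fV n.+1%:R^-1; [rewrite invr_gt0|exists g].
exists g => [n|e e0]; first by case: (gP n).
have mfg n := measurable_sqr_enormB f (g n) mf (proj1 (VL2 _ (proj1 (gP n)))).
pose S n := [set w | ((e ^+ 2)%:E <= `|(enorm (f w - g n w) ^+ 2)%:E|)%E].
have mS n : measurable (S n).
  rewrite -[S n]setTI; apply: emeasurable_fun_c_infty => //.
  exact: measurableT_comp.
exists (\bigcap_n S n); split.
- exact: bigcapT_measurable.
- apply/eqP; rewrite eq_le measure_ge0 andbT.
  apply/lee_addgt0Pr => c c0; rewrite add0e.
  (* This makes 1/(n+1) at most e^2 c; the squared L2-error is below (n+1)^-2, hence below e^2 c as
     well. *)
  pose n := Num.truncn (e ^+ 2 * c)^-1.
  apply: (@le_trans _ _ (P (S n))).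
    by apply: le_measure; rewrite ?inE//; [exact: bigcapT_measurable|exact: bigcap_inf].
  have e20 : 0 < e ^+ 2 by rewrite exprn_gt0.
  rewrite -(@lee_pmul2l _ (e ^+ 2)%:E)// -EFinM.
  have := le_integral_abse P measurableT (mfg n) e20; rewrite setTI => /le_trans; apply.
  under eq_integral do rewrite gee0_abs ?lee_fin ?sqr_ge0//.
  apply/ltW; apply: lt_le_trans (proj2 (gP n)) _; rewrite lee_fin.
  have n1 : n.+1%:R^-1 <= e ^+ 2 * c.
    by rewrite -[leRHS]invrK lef_pV2 ?posrE ?invr_gt0 ?mulr_gt0// ltW// truncnS_gt.
  apply: le_trans n1; rewrite expr2 ler_piMl ?invr_ge0// invf_le1 ?ltr0n//.
  by rewrite ler1n.
- move=> w /= nw n _; rewrite /S/= ger0_norm ?sqr_ge0// lee_fin.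
  rewrite ler_pXn2r ?nnegrE ?enorm_ge0 ?(ltW e0)// leNgt.
  by apply/negP => fge; apply: nw; exists n.
Qed.

Lemma ae_forall_countable (I : countType) (Q : I -> Omega -> Prop) :
  (forall i, {ae P, forall w, Q i w}) -> {ae P, forall w, forall i, Q i w}.
Proof.
move=> hQ; pose Q' n w := if unpickle n is Some i then Q i w else True.
have : {ae P, forall w, forall n, Q' n w}.
  apply: ae_foralln => n; rewrite /Q'; case: unpickle => [i|]; first exact: hQ.
  exact: aeW.
by apply: filterS => w Qw i; have := Qw (pickle i); rewrite /Q' pickleK.
Qed.

(* A countable family of selectors that meets every rational ball in which
   [X] has a point stands in for a Castaing representation of [X]. *)
Lemma excess_le_of_selectors (X X' : Omega -> set 'rV[R]_d) (r : Omega -> \bar R) :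
  (forall w, closed (X w)) -> set_measurable G X ->
  L2_selectors P G X !=set0 ->
  (forall f, L2_selectors P G X f -> {ae P, forall w, forall e : R, 0 < e ->
     exists2 b, X' w b & ((enorm (f w - b))%:E <= r w + e%:E)%E}) ->
  {ae P, forall w, (hausdorff_excess (X w) (X' w) <= r w)%E}.
Proof.
move=> cX mX [f0 [[mf0 f02] Xf0]] Xr.
pose Y q n w := X w `&` [set y | enorm (map_mx ratr q - y) <= n.+1%:R^-1].
have cY q n w : compact (Y q n w) by exact: compact_closed_eball.
have mY q n : set_measurable G (Y q n).
  move=> E cE; rewrite [Z in G Z](_ : _ = [set w | X w `&`
      ([set y | enorm (map_mx ratr q - y) <= n.+1%:R^-1] `&` E) !=set0]).
    apply: mX; apply: closedI => //.
    by apply: closed_le_fun; exact: continuous_enormB.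
  by apply/seteqP; split=> w /=; rewrite /Y setIA.
pose A q n : set Omega := [set w | Y q n w !=set0].
have GA q n : G (A q n).
  have := mY q n setT closedT; congr (G _).
  by apply/seteqP; split=> w /=; rewrite setIT.
(* The point chosen in the ball is used where [X] meets it; elsewhere the given selector [f0] fills
   in, so that [s q n] is a selector of [X] almost everywhere. *)
pose s q n := glue (A q n) (fun w => lexmin_pt (Y q n w)) f0.
have sY q n w : A q n w -> Y q n w (s q n w).
  by move=> Aw; rewrite /s glue_in//; exact: lexmin_pt_in.
have sX q n : L2_selectors P G X (s q n).
  have ms : vec_measurable G (s q n).
    by apply: glue_measurable => //; exact: lexmin_pt_measurable.
  split; [split=> //|]; last first.
    apply: filterS Xf0 => w Xw; have [/sY[]//|Aw] := pselect (A q n w).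
    by rewrite /s glue_out.
  (* [X] may be unbounded, but the chosen points stay in a fixed ball, so |s q n|^2 is at most the
     constant [c] plus |f0|^2. *)
  pose c : R := (enorm (map_mx ratr q : 'rV[R]_d) + n.+1%:R^-1) ^+ 2.
  have mm f : vec_measurable G f -> vec_measurable measurable f.
    by move=> mf C bC; apply: Gm; exact: mf.
  apply: (@le_lt_trans _ _ (\int[P]_w (c%:E + (enorm (f0 w) ^+ 2)%:E))%E).
    apply: le_integral_ge0 => w _; first by rewrite lee_fin sqr_ge0.
    rewrite -EFinD lee_fin; have [/sY[_ /= sq]|Aw] := pselect (A q n w).
      rewrite -[leLHS]addr0 lerD ?sqr_ge0// /c ler_pXn2r ?nnegrE ?addr_ge0 ?enorm_ge0//.
      have := ler_enorm_dist (map_mx ratr q) (s q n w) 0.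
      rewrite !subr0 (enormBC (s q n w)) addrC => /le_trans; apply.
      by rewrite lerD2l.
    by rewrite /s glue_out// lerDr sqr_ge0.
  rewrite ge0_integralD//; last 3 first.
  - by move=> w _; rewrite lee_fin sqr_ge0.
  - by move=> w _; rewrite lee_fin sqr_ge0.
  - by apply: measurable_sqr_enorm; exact: mm.
  rewrite lte_add_pinfty//.
  have /integrableP[_] := integrable_cst_fin P setT c measurableT
    (le_lt_trans (probability_le1 P measurableT) (ltry 1)).
  by apply: le_lt_trans; apply: le_integral_ge0 => w _ /=; rewrite lee_fin ?sqr_ge0// ler_norm.
have := ae_forall_countable ('rV[rat]_d * nat)%type
  (fun qn w => forall e : R, 0 < e ->
     exists2 b, X' w b & ((enorm (s qn.1 qn.2 w - b))%:E <= r w + e%:E)%E)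
  (fun qn => Xr _ (sX qn.1 qn.2)).
apply: filterS => w sw; apply: hausdorff_excess_le => a Xa e e0.
(* Both [a] and [s q n w] are within 1/(n+1) of [q], hence less than e/2 apart; the other e/2 is the
   slack of the point in [X' w]. *)
pose n := Num.truncn (4 / e).
have ne : 4 * n.+1%:R^-1 < e.
  by rewrite ltr_pdivrMr// mulrC -ltr_pdivrMr// truncnS_gt.
have [|q aq] := rational_approx a (n.+1%:R^-1 : R); first by rewrite invr_gt0.
have Aw : A q n w by exists a; split => //=; rewrite enormBC ltW.
have [_ /= sq] := sY q n w Aw.
have [|b X'b sb] := sw (q, n) (e / 2); first by rewrite divr_gt0.
exists b => //.
apply: (@le_trans _ _ ((e / 2)%:E + (enorm (s q n w - b))%:E)%E).
  rewrite -EFinD lee_fin (le_trans (ler_enorm_dist (s q n w) _ _))// lerD2r.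
  have := ler_enorm_dist (map_mx ratr q) a (s q n w).
  by move: (n.+1%:R^-1 : R) ne aq sq => k; lra.
apply: le_trans (leeD2l _ sb) _.
by rewrite addeCA -EFinD -splitr.
Qed.

(** A selector of [X] is an L2-limit of elements [g n] of the hull of [V], and each [g n] has a
    companion that is a selector of [X']. At a given [w] one index with [g n w] close to [f w]
    already yields the required point of [X' w]. *)
Lemma excess_closed_dec_le V V' (X X' : Omega -> set 'rV[R]_d) (r : Omega -> \bar R) :
  V !=set0 -> V `<=` L2 P measurable -> V' `<=` L2 P measurable ->
  (forall w, closed (X w)) -> set_measurable G X ->
  L2_selectors P G X = closed_dec P G V ->
  L2_selectors P G X' = closed_dec P G V' ->
  (forall v, V v -> exists2 v', V' v' &
     {ae P, forall w, ((enorm (v w - v' w))%:E <= r w)%E}) ->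
  {ae P, forall w, X w !=set0} /\
  {ae P, forall w, (hausdorff_excess (X w) (X' w) <= r w)%E}.
Proof.
move=> [v Vv] VL2 V'L2 cX mX XV XV' VV'.
have Xv : L2_selectors P G X v.
  by rewrite XV; apply: dec_sub_closure => // M [_]; exact.
split; first by case: Xv => _; apply: filterS => w; exists (v w).
apply: excess_le_of_selectors => //; first by exists v.
move=> f; rewrite XV => /(L2_closure_ae_approx _ _ (dec_L2 _ VL2))[g Vg fg].
have fg' n : {ae P, forall w, exists2 b, X' w b & ((enorm (g n w - b))%:E <= r w)%E}.
  have [g' Vg' gg'] := dec_companion V V' r VV' (g n) (Vg n).
  have : L2_selectors P G X' g' by rewrite XV'; exact: dec_sub_closure.
  by case=> _; move: gg'; apply: filterS2 => w gg' X'g'; exists (g' w).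
have fgk k : {ae P, forall w, exists n, enorm (f w - g n w) < k.+1%:R^-1}.
  by apply: fg; rewrite invr_gt0.
move: (ae_foralln fg') (ae_foralln fgk); apply: filterS2 => w gb fw e e0.
pose k := Num.truncn e^-1.
have ke : k.+1%:R^-1 <= e by rewrite -[leRHS]invrK lef_pV2 ?posrE ?invr_gt0// ltW// truncnS_gt.
have [n fgn] := fw k; have [b X'b gnb] := gb n; exists b => //.
apply: (@le_trans _ _ ((enorm (g n w - b))%:E + e%:E)%E); last exact: leeD2r.
rewrite -EFinD lee_fin [leRHS]addrC (le_trans (ler_enorm_dist (g n w) _ _))// lerD2r.
by rewrite (le_trans (ltW fgn)).
Qed.

End decomposable_hulls.

(** Completeness makes the added null sets events, and the path values up to time [t] are measurable
    since [t <= T]. *)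
Lemma augmented_sigma_measurable {R : realType} {disp : measure_display}
    {Omega : measurableType disp} (P : probability Omega R) (T : R) {m : nat}
    (B : R -> Omega -> 'rV[R]_m) (t : R) :
  measure_is_complete P -> is_brownian P T B -> t <= T ->
  augmented_sigma P B t `<=` measurable.
Proof.
move=> hP [mB _ _ _ _] tT; apply: smallest_sub; first exact: sigma_algebra_measurable.
move=> A [[s [C [/andP[s0 st] bC ->]]]|]; last exact: hP.
by apply: mB => //; rewrite s0 (le_trans st).
Qed.

Theorem theorem4p3 (R : realType) (disp : measure_display)
    (Omega : measurableType disp) (P : probability Omega R)
    (hP : measure_is_complete P) (T : R) (m d : nat)
    (B : R -> Omega -> 'rV[R]_m) (hB : is_brownian P T B)
    (F F' : R -> Omega -> set 'rV[R]_d)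
    (hF : A2 P T (augmented_sigma P B) F)
    (hF' : A2 P T (augmented_sigma P B) F')
    (hFF' : (\int[P]_w \int[lebesgue_measure]_(s in `[0%R, T])
               hausdorff_dist (F s w) (F' s w) ^+ 2 < +oo)%E)
    (t0 t : R) (ht0 : 0 <= t0) (ht0t : t0 < t) (htT : t <= T)
    (X X' : Omega -> set 'rV[R]_d)
    (hX : is_set_integral P T (augmented_sigma P B) F t0 t X)
    (hX' : is_set_integral P T (augmented_sigma P B) F' t0 t X') :
  {ae P, forall w,
    (hausdorff_dist (X w) (X' w) ^+ 2 <=
     (t - t0)%:E * \int[lebesgue_measure]_(s in `[t0, t])
                     hausdorff_dist (F s w) (F' s w) ^+ 2)%E}.
Proof.
set G := augmented_sigma P B in hF hF' hX hX' *.
have sG s : sigma_algebra setT (G s) by exact: smallest_sigma_algebra.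
have Gm : G t `<=` measurable by exact: (augmented_sigma_measurable P T B).
pose H w := ((t - t0)%:E * \int[lebesgue_measure]_(s in `[t0, t])
               hausdorff_dist (F s w) (F' s w) ^+ 2)%E.
have H0 w : (0 <= H w)%E.
  rewrite mule_ge0 ?lee_fin ?subr_ge0 ?(ltW ht0t)//.
  by apply: integral_ge0 => s _; exact: sqre_ge0.
(* An excess compares distances, not their squares, so the common bound is the extended square root
   of [H w], which may be infinite. *)
have le_sqrtH w (x : R) : 0 <= x -> ((x ^+ 2)%:E <= H w)%E -> (x%:E <= sqrte (H w))%E.
  by move=> x0 xH; rewrite -[leLHS](gee0_abs (x := x%:E))// -sqrte_sqr lee_sqrt.
case: hX => cX mX XV; case: hX' => cX' mX' X'V'.
have VL2 (F1 : R -> Omega -> set 'rV[R]_d) :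
    [set vec_integral t0 t f | f in S2 P T G F1] `<=` L2 P measurable.
  by move=> _ [f Sf <-]; exact: (vec_integral_L2 P T G t0 t ht0 ht0t htT F1 f Sf).
have V0 (F1 : R -> Omega -> set 'rV[R]_d) :
    A2 P T G F1 -> [set vec_integral t0 t f | f in S2 P T G F1] !=set0.
  by move=> [_ _ [f Sf]]; exists (vec_integral t0 t f), f.
(* Stated for any ordered pair with the same distance function, so that it serves (F, F') and, by
   symmetry of the distance, (F', F) with one bound [H]. *)
have companion (F1 F2 : R -> Omega -> set 'rV[R]_d) : A2 P T G F1 -> A2 P T G F2 ->
  (fun s w => hausdorff_dist (F1 s w) (F2 s w)) =
  (fun s w => hausdorff_dist (F s w) (F' s w)) ->
  forall v, [set vec_integral t0 t f | f in S2 P T G F1] v ->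
  exists2 v', [set vec_integral t0 t f | f in S2 P T G F2] v' &
    {ae P, forall w, ((enorm (v w - v' w))%:E <= sqrte (H w))%E}.
  move=> hF1 hF2 F12 _ [f Sf <-].
  have hd s w : hausdorff_dist (F1 s w) (F2 s w) = hausdorff_dist (F s w) (F' s w).
    exact: (congr1 (fun h => h s w) F12).
  have [|f' Sf' ff'] := vec_integral_companion P T G (fun s _ => sG s) t0 t ht0 ht0t htT
      F1 F2 f hF1 hF2 _ Sf.
    by under eq_integral do under eq_integral do rewrite hd.
  exists (vec_integral t0 t f'); first by exists f'.
  apply: filterS ff' => w ff'; apply: le_sqrtH; first exact: enorm_ge0.
  by apply: le_trans ff' _; under eq_integral do rewrite hd.
have [X0 XX'] := excess_closed_dec_le P (G t) (sG t) Gm _ _ X X' _ (V0 F hF)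
   (VL2 F) (VL2 F') cX mX XV X'V' (companion F F' hF hF' erefl).
have FF'C : (fun s w => hausdorff_dist (F' s w) (F s w)) =
            (fun s w => hausdorff_dist (F s w) (F' s w)).
  by apply/funext => s; apply/funext => w; exact: hausdorff_distC.
have [_ X'X] := excess_closed_dec_le P (G t) (sG t) Gm _ _ X' X _ (V0 F' hF')
   (VL2 F') (VL2 F) cX' mX' X'V' XV (companion F' F hF' hF FF'C).
move: X0 XX' X'X; apply: filterS3 => w X0 XX' X'X.
(* Squaring the bound back requires a nonnegative distance, which is where [X w] being almost surely
   nonempty enters. *)
rewrite -/(H w) -(sqr_sqrte (H0 w)); apply: lee_sqr_ge0; first exact: hausdorff_dist_ge0.
by rewrite /hausdorff_dist ge_max XX' X'X.
Qed.
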